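(* Let $|q|<1$, $|\rho|<1$ and $x,y\in S(q)$. Then the following hold. (i) For all integers $i,j\ge 0$, $$H_i(x|q)\,H_j(y|q)\,\frac{\prod_{k=0}^{\infty}\omega\!\left(\frac{x\sqrt{1-q}}{2},\frac{y\sqrt{1-q}}{2}\,\Big|\,\rho q^{k}\right)}{(\rho^2;q)_\infty}=\sum_{k=0}^{\infty}(-1)^k q^{\binom{k}{2}}\frac{\rho^k}{[k]_q!}\,Q_{i+k,j+k}(x,y|\rho,q).$$ (ii) In particular, $$\frac{1}{\sum_{n\ge 0}\frac{\rho^n}{[n]_q!}H_n(x|q)H_n(y|q)}=\frac{\prod_{k=0}^{\infty}\omega\!\left(\frac{x\sqrt{1-q}}{2},\frac{y\sqrt{1-q}}{2}\,\Big|\,\rho q^{k}\right)}{(\rho^2;q)_\infty}=\sum_{k=0}^{\infty}(-1)^k q^{\binom{k}{2}}\frac{\rho^k}{[k]_q!}\,Q_{k,k}(x,y|\rho,q).$$ Moreover, for $q=1$, all $x,y\in\mathbb{R}$ and $|\rho|<1/2$, $$\frac{1}{\sum_{n\ge 0}\frac{\rho^n}{n!}H_n(x|1)H_n(y|1)}=\sum_{k=0}^{\infty}(-1)^k\frac{\rho^k}{k!}\,Q_{k,k}(x,y|\rho,1).$$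
   Context: All parameters $q,\rho$ are real, $-1<q\le 1$, and $0^0=1$. Put $[0]_q=0$, $[n]_q=1+q+\dots+q^{n-1}$, $[n]_q!=\prod_{j=1}^n[j]_q$, $[0]_q!=1$; $\binom{n}{k}_q=\frac{[n]_q!}{[n-k]_q!\,[k]_q!}$ for $n\ge k\ge 0$ and $0$ otherwise; $(a;q)_0=1$, $(a;q)_n=\prod_{j=0}^{n-1}(1-aq^j)$, and, for $|q|<1$, $(a;q)_\infty=\prod_{j\ge 0}(1-aq^j)$. Let $S(q)=\left[-\frac{2}{\sqrt{1-q}},\frac{2}{\sqrt{1-q}}\right]$ if $|q|<1$ and $S(1)=\mathbb{R}$. The $q$-Hermite polynomials are defined by $H_{-1}(x|q)=0$, $H_0(x|q)=1$, $H_{n+1}(x|q)=xH_n(x|q)-[n]_qH_{n-1}(x|q)$ for $n\ge 0$. The (rescaled) Al-Salam--Chihara polynomials are defined by $P_0(x|y,\rho,q)=1$, $P_1(x|y,\rho,q)=x-\rho y$ and, for $n\ge 1$, $P_{n+1}(x|y,\rho,q)=(x-\rho yq^n)P_n(x|y,\rho,q)-[n]_q(1-\rho^2q^{n-1})P_{n-1}(x|y,\rho,q)$. $\omega(x,y|\rho)=(1-\rho^2)^2-4\rho(1+\rho^2)xy+4\rho^2(x^2+y^2)$. For $|\rho|<1$, $x,y\in S(q)$ and integers $i,j\ge 0$ let $\gamma_{i,j}(x,y|\rho,q)=\sum_{n\ge 0}\frac{\rho^n}{[n]_q!}H_{n+i}(x|q)H_{n+j}(y|q)$. The polynomials $Q_{i,j}(x,y|\rho,q)$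 (of degree $i+j$ in $x,y$) are those satisfying $\gamma_{i,j}(x,y|\rho,q)=Q_{i,j}(x,y|\rho,q)\,\gamma_{0,0}(x,y|\rho,q)$ for all $x,y\in S(q)$; they are given explicitly, for all $x,y\in\mathbb{R}$, by $$Q_{i,j}(x,y|\rho,q)=\sum_{s=0}^{j}(-1)^s q^{\binom{s}{2}}\binom{j}{s}_q\rho^s H_{j-s}(y|q)\,\frac{P_{i+s}(x|y,\rho,q)}{(\rho^2;q)_{i+s}}.$$ *)

(* Defs.v *)
From mathcomp Require Import all_boot all_order all_algebra.
From mathcomp Require Import all_classical all_reals all_analysis.

Set Implicit Arguments.
Unset Strict Implicit.
Unset Printing Implicit Defensive.

Import Order.TTheory GRing.Theory Num.Theory.
Import numFieldNormedType.Exports.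

Local Open Scope classical_set_scope.
Local Open Scope ring_scope.

Section QCalculus.
Context {R : realType}.
Implicit Types (q rho x y a : R) (n k i j : nat).

Definition qnum q n : R := \sum_(j < n) q ^+ j.

Definition qfact q n : R := \prod_(1 <= j < n.+1) qnum q j.

Definition qbinom q n k : R :=
  if (k <= n)%N then qfact q n / (qfact q (n - k) * qfact q k) else 0.

Definition qpoch a q n : R := \prod_(j < n) (1 - a * q ^+ j).

Definition qpoch_inf a q : R := limn (qpoch a q).

(* Meant for -1 < q <= 1. *)
Definition qsupport q : set R :=
  if q == 1 then [set: R]
  else `[- (2 / Num.sqrt (1 - q)), 2 / Num.sqrt (1 - q)]%classic.

(* H_1 = x comes from H_1 = x H_0 - [0]_q H_{-1} with [0]_q = 0, H_{-1} = 0. *)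
Fixpoint qHermite q n x : R :=
  match n with
  | 0 => 1
  | n1.+1 =>
    match n1 with
    | 0 => x
    | n2.+1 => x * qHermite q n1 x - qnum q n1 * qHermite q n2 x
    end
  end.

Fixpoint AlSalamChihara q rho y n x : R :=
  match n with
  | 0 => 1
  | n1.+1 =>
    match n1 with
    | 0 => x - rho * y
    | n2.+1 =>
      (x - rho * y * q ^+ n1) * AlSalamChihara q rho y n1 x
      - qnum q n1 * (1 - rho ^+ 2 * q ^+ n2) * AlSalamChihara q rho y n2 x
    end
  end.

Definition omega x y rho : R :=
  (1 - rho ^+ 2) ^+ 2 - 4 * rho * (1 + rho ^+ 2) * x * y
  + 4 * rho ^+ 2 * (x ^+ 2 + y ^+ 2).

Definition omega_prod q rho x y n : R :=
  \prod_(k < n) omega (x * Num.sqrt (1 - q) / 2) (y * Num.sqrt (1 - q) / 2)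
                      (rho * q ^+ k).

Definition omega_prod_inf q rho x y : R := limn (omega_prod q rho x y).

(* Q_{i,j}(x,y|rho,q), by its explicit formula: for |rho| < 1 and x, y in S(q)
   it is the factor in gamma_{i,j} = Q_{i,j} gamma_{0,0}, where gamma_{i,j} is
   the sum over n of rho^n / [n]_q! * H_{n+i}(x|q) * H_{n+j}(y|q). *)
Definition Qpoly q rho i j x y : R :=
  \sum_(s < j.+1)
    (-1) ^+ s * q ^+ 'C(s, 2) * qbinom q j s * rho ^+ s
    * qHermite q (j - s) y
    * (AlSalamChihara q rho y (i + s) x / qpoch (rho ^+ 2) q (i + s)).

End QCalculus.

(* Main.v *)
Require Import Defs.
From mathcomp Require Import all_boot all_order all_algebra.
From mathcomp Require Import all_classical all_reals all_analysis.
From mathcomp Require Import ring lra zify.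

Set Implicit Arguments.
Unset Strict Implicit.
Unset Printing Implicit Defensive.

Import Order.TTheory GRing.Theory Num.Theory.
Import numFieldNormedType.Exports.

Local Open Scope classical_set_scope.
Local Open Scope ring_scope.

(** The series [gamma_{i,j}] of general term
    [rho ^+ n / [n]_q! * H_{n+i}(x) * H_{n+j}(y)] converge absolutely, and the
    three-term recurrence of the q-Hermite polynomials, applied coefficient by
    coefficient, yields linear relations between them ([kernel_Sl],
    [kernel_Sr]). These relations express [gamma_{i,0}] through the
    Al-Salam-Chihara polynomials, since they amount to the recurrence defining
    the latter, and then every [gamma_{i,j}] as [Q_{i,j} * gamma_{0,0}]
    ([kernel_Qpoly]).

    Since [rho ^+ k / [k]_q! * gamma_{i+k,j+k}] is the sum over [N] of
    [qbinom q N k] times the [N]-th term of [gamma_{i,j}], the alternating sum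
    over [k] of the weights [(-1) ^+ k * q ^+ 'C(k, 2)] collapses to the term
    [N = 0], that is, to [H_i(x) * H_j(y)]. No exchange of infinite sums is
    needed: the sum over [k <= K] of [(-1) ^+ k * q ^+ 'C(k, 2) * qbinom q N k]
    has the closed form [(-1) ^+ K * q ^+ 'C(K+1, 2) * qbinom q (N-1) K] for
    [N > 0], which vanishes for [N <= K]. So a partial sum differs from its
    limit by at most the tail of a convergent series, as soon as the terms of
    [gamma_{i,j}] remain summable after multiplication by a bound of the
    q-binomial coefficients ([alternating_kernel_sum]). That bound is a
    constant if [|q| < 1], and [2 ^ N] if [q = 1], whence the condition
    [|rho| < 1/2]. The case [i = j = 0] shows moreover that [gamma_{0,0}] is
    not zero, and division by [gamma_{0,0}] gives the expansions.

    For [|q| < 1], comparison of coefficients shows that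
    [omega(rho) * gamma_{0,0}(rho) =
     (1 - rho^2) * (1 - rho^2 * q) * gamma_{0,0}(rho * q)]
    ([poisson_mehler_step]). Iteration and continuity at 0 give the
    Poisson-Mehler formula, which identifies [1 / gamma_{0,0}] with the quotient
    of the two infinite products and proves that the numerator converges. The
    same method, applied to Euler's series of general term [a ^+ n / (q;q)_n],
    shows that [(a;q)_n] converges to a nonzero limit ([qpoch_cvg]).

    Absolute convergence rests on the fact that [H_n(x) ^+ 2 / [n]_q!] grows
    subexponentially. For [q = 1] a weighted square inequality suffices; for
    [|q| < 1], the hypothesis that [x] lies in [S(q)] makes the normalized
    recurrence a perturbation of the Chebyshev recurrence, which has an
    invariant quadratic form ([energy_step]). *)

(** * Convergent series and subexponential sequences *)

Section Series.
Context {R : realType}.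
Implicit Types (u v W : nat -> R) (l m a r s : R).

(** The series of general term [u] converges to [l]. The conjunction is
    equivalent to [series u @ \oo --> l], see [hassumP]. *)
Definition hassum u l : Prop := cvgn (series u) /\ limn (series u) = l.

Lemma hassumP u l : hassum u l <-> series u @ \oo --> l.
Proof.
split=> [[cu <-] //|ul]; split; last exact: cvg_lim.
by apply/cvg_ex; exists l.
Qed.

Lemma hassum_lim u l : hassum u l -> limn (series u) = l.
Proof. by case. Qed.

Lemma hassum_cvg u l : hassum u l -> cvgn (series u).
Proof. by case. Qed.

Lemma cvg_hassum u : cvgn (series u) -> hassum u (limn (series u)).
Proof. by []. Qed.

Lemma hassum_unique u l m : hassum u l -> hassum u m -> l = m.
Proof. by move=> /hassum_lim <- /hassum_lim <-. Qed.

Lemma eq_hassum u v l : hassum u l -> u =1 v -> hassum v l.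
Proof. by move=> ul /funext <-. Qed.

Lemma hassumD u v l m :
  hassum u l -> hassum v m -> hassum (fun n => u n + v n) (l + m).
Proof.
move=> /hassumP ul /hassumP vm; apply/hassumP.
rewrite (_ : series _ = series u + series v).
  exact: cvgD.
by rewrite -seriesD.
Qed.

Lemma hassumZ a u l : hassum u l -> hassum (fun n => a * u n) (a * l).
Proof.
move=> /hassumP ul; apply/hassumP.
rewrite (_ : series _ = fun n => a * series u n).
  by apply: cvgM ul; exact: cvg_cst.
by apply/funext => n; rewrite /series /= mulr_sumr.
Qed.

Lemma hassumB u v l m :
  hassum u l -> hassum v m -> hassum (fun n => u n - v n) (l - m).
Proof.
move=> ul vm; rewrite -[- m]mulN1r.
apply: (eq_hassum (hassumD ul (hassumZ (-1) vm))) => n.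
by rewrite mulN1r.
Qed.

Lemma hassum_sum K (F : nat -> nat -> R) (L : nat -> R) :
  (forall k, (k < K)%N -> hassum (F k) (L k)) ->
  hassum (fun n => \sum_(k < K) F k n) (\sum_(k < K) L k).
Proof.
elim: K => [|K IH] FL.
  rewrite big_ord0; apply/hassumP.
  rewrite (_ : series _ = fun=> 0); first exact: cvg_cst.
  by apply/funext => n; rewrite /series /= big1// => i _; rewrite big_ord0.
rewrite big_ord_recr /=.
apply: (@eq_hassum (fun n => \sum_(k < K) F k n + F K n)).
  by apply: hassumD; [apply: IH => k kK; apply: FL; apply: ltnW | exact: FL].
by move=> n; rewrite big_ord_recr.
Qed.

Lemma hassum_shiftn k u l : (forall n, (n < k)%N -> u n = 0) ->
  hassum (fun n => u (n + k)%N) l -> hassum u l.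
Proof.
move=> u0 /hassumP ul; apply/hassumP; rewrite -(cvg_shiftn k).
rewrite (_ : [sequence _]_n = series (fun n => u (n + k)%N)) //.
apply/funext => n; rewrite /series /= addnC.
rewrite (big_cat_nat _ (leq_addr n k)) //= big_nat_cond big1 ?add0r.
  by rewrite -[X in \sum_(X <= _ < _) _]add0n big_addn addKn.
by move=> i; rewrite andbT => /andP[_ /u0].
Qed.

Lemma hassum_head l : hassum (fun n => if n is 0 then l else 0) l.
Proof.
apply/hassumP; rewrite -(cvg_shiftS _) (_ : [sequence _]_n = fun=> l).
  exact: cvg_cst.
by apply/funext => n; rewrite /series /= big_nat_recl //= big1 ?addr0.
Qed.

Lemma hassum_tail (b : nat -> R) (l : R) K : hassum b l ->
  hassum (fun n => if (n < K)%N then 0 else b n) (l - series b K).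
Proof.
move=> bl; apply: (@hassum_shiftn K) => [n ->//|].
apply/hassumP.
rewrite (_ : series _ = fun n => series b (n + K)%N - series b K).
  apply: cvgB; last exact: cvg_cst.
  by have /hassumP := bl; rewrite -(cvg_shiftn K).
apply/funext => n; rewrite sub_series leq_addl /=.
rewrite -[X in \sum_(X <= _ < _) _]add0n big_addn addnK.
by apply: eq_bigr => m _; rewrite ltnNge leq_addl.
Qed.

(** The sequence [u] delayed by one step, with a leading zero: multiplication
    of the generating function by its variable. *)
Definition delay u n : R := if n is n'.+1 then u n' else 0.

Lemma hassum_delay u l : hassum u l -> hassum (delay u) l.
Proof.
move=> ul; apply: (@hassum_shiftn 1); first by case.
by apply: (eq_hassum ul) => n; rewrite addn1.
Qed.

Lemma hassum_le u v l m :
  hassum u l -> hassum v m -> (forall n, u n <= v n) -> l <= m.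
Proof.
move=> ul vm uv; rewrite -(hassum_lim ul) -(hassum_lim vm).
by apply: lim_series_le => //; [exact: hassum_cvg ul | exact: hassum_cvg vm].
Qed.

Lemma hassum_norm_le u v l m :
  hassum u l -> hassum v m -> (forall n, `|u n| <= v n) -> `|l| <= m.
Proof.
move=> ul vm uv; rewrite ler_norml; apply/andP; split.
  rewrite -mulN1r; apply: (hassum_le (hassumZ (-1) vm) ul) => n.
  by rewrite mulN1r; have := uv n; rewrite ler_norml => /andP[].
by apply: (hassum_le ul vm) => n; exact: le_trans (ler_norm _) (uv n).
Qed.

Lemma cvg_series_dominated u v : (forall n, `|u n| <= v n) ->
  cvgn (series v) -> cvgn (series (fun n => `|u n|)).
Proof.
by move=> uv; apply: series_le_cvg => // n; exact: le_trans (uv n).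
Qed.

Lemma cvg_series_norm u : cvgn (series (fun n => `|u n|)) -> cvgn (series u).
Proof. by move=> cu; apply: normed_cvg. Qed.

(** Sequences growing at most subexponentially: [u] is [O(s ^ n)] for each
    [s > 1]. They are the coefficient sequences of the power series that
    converge absolutely on the open unit disc. *)
Definition subexp u :=
  forall s, 1 < s -> exists C, forall n, `|u n| <= C * s ^+ n.

Lemma bound_of_ratio s W : 0 < s -> (forall n, 0 <= W n) ->
  (exists N, forall n, (N <= n)%N -> W n.+1 <= s * W n) ->
  exists C, forall n, W n <= C * s ^+ n.
Proof.
move=> s0 W0 [N WN]; exists (\sum_(k < N.+1) W k / s ^+ k).
have C0 : 0 <= \sum_(k < N.+1) W k / s ^+ k.
  by apply: sumr_ge0 => k _; rewrite divr_ge0 // exprn_ge0 // ltW.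
have small n : (n <= N)%N -> W n <= (\sum_(k < N.+1) W k / s ^+ k) * s ^+ n.
  move=> nN; rewrite -ler_pdivrMr ?exprn_gt0 //.
  have nN1 : (n < N.+1)%N by [].
  rewrite (bigD1 (Ordinal nN1)) //= lerDl; apply: sumr_ge0 => k _.
  by rewrite divr_ge0 // exprn_ge0 // ltW.
move=> n; have [/small//|/ltnW Nn] := leqP n N.
rewrite -(subnK Nn); elim: (n - N)%N => [|k IH]; first exact: small.
rewrite addSn exprS mulrCA; apply: le_trans (WN _ (leq_addl _ _)) _.
by rewrite ler_pM2l.
Qed.

Lemma subexp_ratio W : (forall n, 0 <= W n) ->
  (forall s, 1 < s -> exists N, forall n, (N <= n)%N -> W n.+1 <= s * W n) ->
  subexp W.
Proof.
move=> W0 Ws s s1; have s0 : 0 < s by exact: lt_trans s1.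
have [C WC] := bound_of_ratio s0 W0 (Ws s s1).
by exists C => n; rewrite ger0_norm.
Qed.

Lemma subexp_le u v : (forall n, `|u n| <= `|v n|) -> subexp v -> subexp u.
Proof.
by move=> uv vs s /vs[C vC]; exists C => n; exact: le_trans (uv n) (vC n).
Qed.

Lemma subexpM u v : subexp u -> subexp v -> subexp (fun n => u n * v n).
Proof.
move=> us vs s s1; have s0 : 0 <= s by rewrite ltW // (lt_trans _ s1).
(* the rate s is split evenly between the two factors *)
have t1 : 1 < Num.sqrt s by rewrite -sqrtr1 ltr_sqrt // (lt_trans _ s1).
have [C uC] := us _ t1; have [D vD] := vs _ t1; exists (C * D) => n.
rewrite normrM -{1}(sqr_sqrtr s0) -exprM mulnC exprM expr2 mulrACA.
by rewrite ler_pM.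
Qed.

Lemma subexpD u v : subexp u -> subexp v -> subexp (fun n => u n + v n).
Proof.
move=> us vs s s1; have [C uC] := us _ s1; have [D vD] := vs _ s1.
exists (C + D) => n; rewrite mulrDl (le_trans (ler_normD _ _)) //.
exact: lerD.
Qed.

Lemma subexpS u : subexp u -> subexp (fun n => u n.+1).
Proof.
move=> us s s1; have [C uC] := us _ s1; exists (C * s) => n.
by rewrite -mulrA -exprS.
Qed.

Lemma subexp_bounded u a : (forall n, `|u n| <= a) -> subexp u.
Proof.
move=> ua s s1; exists a => n; rewrite (le_trans (ua n)) // ler_peMr //.
  exact: le_trans (ua 0).
by rewrite exprn_ege1 // ltW.
Qed.

Lemma subexp_cvg u r : subexp u -> `|r| < 1 ->
  cvgn (series (fun n => `|r ^+ n * u n|)).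
Proof.
move=> us r1.
(* a ratio s > 1 with |r| * s < 1 *)
have [s s1 rs1] : exists2 s, 1 < s & `|r| * s < 1.
  exists (2 / (1 + `|r|)); have := normr_ge0 r => r0.
    by rewrite ltr_pdivlMr; lra.
  by rewrite mulrA ltr_pdivrMr; lra.
have [C uC] := us s s1.
apply: (@cvg_series_dominated _ (geometric C (`|r| * s))).
  move=> n; rewrite /geometric /= normrM normrX exprMn mulrCA.
  by rewrite ler_wpM2l // exprn_ge0.
apply: is_cvg_geometric_series; rewrite ger0_norm // mulr_ge0 //.
exact: le_trans (ltW s1).
Qed.

Lemma cvg_expr_near a e : `|a| < 1 -> 0 < e ->
  exists N, forall n, (N <= n)%N -> `|a| ^+ n <= e.
Proof.
move=> a1 e0; have aa1 : `| `|a| | < 1 by rewrite normr_id.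
have /cvgrPdist_le/(_ e e0)[N _ Nh] := cvg_expr aa1.
exists N => n Nn; have := Nh n Nn.
by rewrite /= sub0r normrN ger0_norm // exprn_ge0.
Qed.

(** Continuity at 0 of an absolutely convergent power series, along the points
    [a * q ^+ m]. *)
Lemma power_series_cvg0 (c : nat -> R) (a q : R) (f : nat -> R) :
  `|q| < 1 -> cvgn (series (fun n => `|a ^+ n * c n|)) ->
  (forall m : nat, hassum (fun n => (a * q ^+ m) ^+ n * c n) (f m)) ->
  f @ \oo --> c 0.
Proof.
move=> q1 cc fh; set M := limn (series (fun n => `|a ^+ n * c n|)).
have MS : hassum (fun n => `|a ^+ n * c n|) M by exact: cvg_hassum.
have bd (m : nat) : `|c 0 - f m| <= `|q| ^+ m * M.
  apply: (hassum_norm_le (hassumB (hassum_head (c 0)) (fh m))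
                         (hassumZ (`|q| ^+ m) MS)) => n.
  case: n => [|n] /=.
    by rewrite !expr0 !mul1r subrr normr0 mulr_ge0 // exprn_ge0.
  rewrite sub0r normrN exprMn mulrAC normrM mulrC ler_wpM2r //.
  rewrite -exprM normrX mulnS exprD ler_piMr ?exprn_ge0 // exprn_ile1 //.
  exact: ltW.
apply/cvgrPdist_le => e e0.
have M0 : 0 <= M by have := bd 0; rewrite expr0 mul1r; apply: le_trans.
have M10 : 0 < M + 1 by lra.
have [N Nh] := cvg_expr_near q1 (divr_gt0 e0 M10).
exists N => // m Nm; apply: le_trans (bd m) _.
have := Nh m Nm; rewrite ler_pdivlMr // => h; apply: le_trans h.
by rewrite ler_wpM2l ?exprn_ge0 //; lra.
Qed.

End Series.

(** * q-factorials and q-binomial coefficients *)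

Section QAlgebra.
Context {R : realType}.
Variable q : R.
Implicit Types (n k K : nat).

Lemma qnum0 : qnum q 0 = 0.
Proof. by rewrite /qnum big_ord0. Qed.

Lemma qnumS n : qnum q n.+1 = qnum q n + q ^+ n.
Proof. by rewrite /qnum big_ord_recr. Qed.

Lemma qnumD m n : qnum q (m + n) = qnum q m + q ^+ m * qnum q n.
Proof.
elim: n => [|n IH]; first by rewrite addn0 qnum0 mulr0 addr0.
by rewrite addnS !qnumS IH exprD mulrDr addrA.
Qed.

Lemma subr1_qnum n : (1 - q) * qnum q n = 1 - q ^+ n.
Proof.
elim: n => [|n IH]; first by rewrite qnum0 mulr0 expr0 subrr.
by rewrite qnumS mulrDr IH exprS; ring.
Qed.

Lemma qfact0 : qfact q 0 = 1.
Proof. by rewrite /qfact big_geq. Qed.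

Lemma qfactS n : qfact q n.+1 = qfact q n * qnum q n.+1.
Proof. by rewrite /qfact big_nat_recr. Qed.

Lemma qpoch0 (a : R) : qpoch a q 0 = 1.
Proof. by rewrite /qpoch big_ord0. Qed.

Lemma qpochS (a : R) n : qpoch a q n.+1 = qpoch a q n * (1 - a * q ^+ n).
Proof. by rewrite /qpoch big_ord_recr. Qed.

Lemma qpoch_qfact n : qpoch q q n = (1 - q) ^+ n * qfact q n.
Proof.
elim: n => [|n IH]; first by rewrite qpoch0 qfact0 mulr1.
by rewrite qpochS IH qfactS -exprS -subr1_qnum exprS; ring.
Qed.

Hypothesis qN1 : -1 < q.
Hypothesis q1 : q <= 1.

Lemma qnum_gt0 n : 0 < qnum q n.+1.
Proof.
have [q0|q0] := leP 0 q.
  rewrite /qnum big_ord_recl /= expr0; apply: ltr_wpDr => //.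
  by apply: sumr_ge0 => i _; rewrite exprn_ge0.
have h : 0 < 1 - q by lra.
rewrite -(pmulr_rgt0 _ h) subr1_qnum subr_gt0.
apply: le_lt_trans (ler_norm _) _; rewrite normrX exprn_ilt1 //.
by rewrite ltr_norml qN1 (lt_trans q0).
Qed.

Lemma qnum_neq0 n : qnum q n.+1 != 0.
Proof. by rewrite gt_eqF // qnum_gt0. Qed.

Lemma qnum_le n : qnum q n <= n%:R.
Proof.
rewrite -[n in n%:R]card_ord -sumr_const; apply: ler_sum => i _.
apply: le_trans (ler_norm _) _; rewrite normrX exprn_ile1 // ler_norml.
by rewrite q1 ltW.
Qed.

Lemma qfact_gt0 n : 0 < qfact q n.
Proof.
by elim: n => [|n IH]; [rewrite qfact0 | rewrite qfactS mulr_gt0 // qnum_gt0].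
Qed.

Lemma qfact_neq0 n : qfact q n != 0.
Proof. by rewrite gt_eqF // qfact_gt0. Qed.

Lemma qbinom_gt n k : (n < k)%N -> qbinom q n k = 0.
Proof. by rewrite /qbinom ltnNge => /negbTE ->. Qed.

Lemma qbinomE n k : (k <= n)%N ->
  qbinom q n k = qfact q n / (qfact q (n - k) * qfact q k).
Proof. by rewrite /qbinom => ->. Qed.

Lemma qbinom0 n : qbinom q n 0 = 1.
Proof. by rewrite qbinomE // subn0 qfact0 mulr1 divff // qfact_neq0. Qed.

Lemma qbinomnn n : qbinom q n n = 1.
Proof. by rewrite qbinomE // subnn qfact0 mul1r divff // qfact_neq0. Qed.

(** The first q-Pascal rule. *)
Lemma qbinomS n k :
  qbinom q n.+1 k.+1 = qbinom q n k + q ^+ k.+1 * qbinom q n k.+1.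
Proof.
have [kn|nk] := ltnP k n; last first.
  rewrite (qbinom_gt (_ : n < k.+1)%N) // mulr0 addr0.
  move: nk; rewrite leq_eqVlt => /predU1P[->|nk]; first by rewrite !qbinomnn.
  by rewrite !qbinom_gt.
rewrite !qbinomE ?ltnS ?(ltnW kn) //.
have e : (n - k = (n - k.+1).+1)%N by rewrite subnSK.
rewrite subSS e !qfactS.
have -> : qnum q n.+1 = qnum q k.+1 + q ^+ k.+1 * qnum q (n - k.+1).+1.
  by rewrite -qnumD addnS subnKC.
field.
by rewrite !qfact_neq0 !qnum_neq0.
Qed.

(** The second q-Pascal rule; the exponent [n - k] requires [k <= n]. *)
Lemma qbinomS' n k : (k <= n)%N ->
  qbinom q n.+1 k.+1 = q ^+ (n - k) * qbinom q n k + qbinom q n k.+1.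
Proof.
rewrite leq_eqVlt => /predU1P[->|kn].
  by rewrite !qbinomnn (qbinom_gt (leqnn _)) subnn expr0 mulr1 addr0.
rewrite !qbinomE ?ltnS ?(ltnW kn) //.
have e : (n - k = (n - k.+1).+1)%N by rewrite subnSK.
rewrite subSS e !qfactS.
have -> : qnum q n.+1 = qnum q (n - k.+1).+1 + q ^+ (n - k.+1).+1 * qnum q k.+1.
  by rewrite -qnumD addSn subnK.
field.
by rewrite !qfact_neq0 !qnum_neq0.
Qed.

Lemma qnum_qbinom n k :
  qbinom q n.+1 k * qnum q (n.+1 - k) = qnum q n.+1 * qbinom q n k.
Proof.
have [kn|] := leqP k n; last first.
  rewrite leq_eqVlt => /predU1P[<-|nk].
    by rewrite subnn qnum0 (qbinom_gt (leqnn _)) !mulr0.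
  by rewrite !qbinom_gt ?mulr0 ?mul0r // ltnW.
rewrite !qbinomE ?(leqW kn) // subSn // !qfactS.
field.
by rewrite !qfact_neq0 !qnum_neq0.
Qed.

(** Truncated q-analogue of the vanishing of alternating sums of binomial
    coefficients; the right-hand side is 0 when [N < K]. *)
Lemma sum_alt_qbinom N K :
  \sum_(k < K.+1) (-1) ^+ k * q ^+ 'C(k, 2) * qbinom q N.+1 k =
  (-1) ^+ K * q ^+ 'C(K.+1, 2) * qbinom q N K.
Proof.
elim: K => [|K IH]; first by rewrite big_ord1 !qbinom0 expr0 bin0n.
rewrite big_ord_recr /= IH qbinomS [in RHS]binS bin1 exprD.
by rewrite (exprS (-1)); ring.
Qed.

Lemma sum_alt_qbinom0 K :
  \sum_(k < K.+1) (-1) ^+ k * q ^+ 'C(k, 2) * qbinom q 0 k = 1.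
Proof.
rewrite big_ord_recl /= qbinom0 bin0n !expr0 !mul1r big1 ?addr0 // => i _.
by rewrite qbinom_gt ?mulr0.
Qed.

Lemma qHermiteS n (x : R) :
  qHermite q n.+2 x = x * qHermite q n.+1 x - qnum q n.+1 * qHermite q n x.
Proof. by []. Qed.

(** The three-term recurrence from index 0 on; the value given to
    [qHermite q 0.-1] is irrelevant, since it is multiplied by [qnum q 0 = 0]. *)
Lemma qHermite_rec m (z : R) :
  qHermite q m.+1 z = z * qHermite q m z - qnum q m * qHermite q m.-1 z.
Proof. by case: m => [|m] //; rewrite qnum0 mul0r subr0 /= mulr1. Qed.

End QAlgebra.

Section QOne.
Context {R : realType}.

Lemma qnum_q1 n : qnum (1 : R) n = n%:R.
Proof.
rewrite /qnum (eq_bigr (fun=> 1)) ?sumr_const ?card_ord // => i _.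
by rewrite expr1n.
Qed.

Lemma qfact_q1 n : qfact (1 : R) n = n`!%:R.
Proof.
by elim: n => [|n IH]; rewrite ?qfact0 // qfactS IH qnum_q1 factS natrM mulrC.
Qed.

Lemma qbinom_q1 n k : qbinom (1 : R) n k = 'C(n, k)%:R.
Proof.
have [nk|kn] := ltnP n k; first by rewrite qbinom_gt // bin_small.
rewrite qbinomE // !qfact_q1 -(bin_fact kn) -!natrM mulnC natrM.
by rewrite [(k`! * _)%N]mulnC mulrC mulKf // natrM.
Qed.

Lemma bin_le_exp2 n k : ('C(n, k) <= 2 ^ n)%N.
Proof.
elim: n k => [|n IH] [|k] //; first by rewrite bin0 expn_gt0.
by rewrite binS expnS mul2n -addnn leq_add.
Qed.

End QOne.

(** * Growth of the q-Hermite polynomials *)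

Section Growth.
Context {R : realType}.
Implicit Types (q x y c d : R).

Lemma natr_near (a : R) : exists N, forall n, (N <= n)%N -> a <= n%:R.
Proof.
exists (Num.Def.archi_bound `|a|) => n Nn; apply: le_trans (ler_norm a) _.
apply: le_trans (ltW (archi_boundP (normr_ge0 a))) _.
by rewrite ler_nat.
Qed.

Lemma subexp_natS : subexp (fun n => n.+1%:R : R).
Proof.
apply: subexp_ratio => // s s1; have [N Nh] := natr_near (s - 1)^-1.
have s0 : 0 < s - 1 by lra.
exists N => n /Nh; rewrite -(ler_pM2l s0) divff ?gt_eqF // => h.
by rewrite -[n.+2%:R]natr1 -[n.+1%:R]natr1; lra.
Qed.

(** A weighted form of the inequality [2 a b <= d a ^+ 2 + d^-1 b ^+ 2]. *)
Lemma sqrD_le (a b d : R) : 0 < d ->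
  (a + b) ^+ 2 <= (1 + d) * a ^+ 2 + (1 + d^-1) * b ^+ 2.
Proof.
move=> d0; rewrite -subr_ge0.
have -> : (1 + d) * a ^+ 2 + (1 + d^-1) * b ^+ 2 - (a + b) ^+ 2 =
  (d * a - b) ^+ 2 / d by field; rewrite gt_eqF.
by rewrite divr_ge0 ?sqr_ge0 // ltW.
Qed.

Lemma sqr_qHermite1_subexp x :
  subexp (fun n => qHermite 1 n x ^+ 2 / n`!%:R).
Proof.
pose E n := qHermite 1 n x ^+ 2 / n`!%:R : R.
have E0 n : 0 <= E n by rewrite divr_ge0 ?sqr_ge0.
(* the sum of two consecutive terms grows at most by the factor 1 + d *)
apply: (@subexp_le _ _ (fun n => E n.+1 + E n)).
  by move=> n; rewrite -/(E n) !ger0_norm ?addr_ge0 ?lerDr.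
apply: subexp_ratio => [n|s s1]; first by rewrite addr_ge0.
pose d := s - 1; have d0 : 0 < d by rewrite /d; lra.
have [N Nh] := natr_near ((1 + d^-1) * x ^+ 2 / d).
exists N => n /Nh; rewrite ler_pdivrMr // => h.
suff : E n.+2 <= d * E n.+1 + (1 + d) * E n by rewrite /d; lra.
rewrite /E qHermiteS qnum_q1.
set A := qHermite _ n.+1 x; set B := qHermite _ n x.
have f0 : 0 < n`!%:R :> R by rewrite ltr0n fact_gt0.
have n1 : 0 < n.+1%:R :> R by rewrite ltr0n.
have n2 : 0 < n.+2%:R :> R by rewrite ltr0n.
rewrite !factS !natrM.
have -> : d * (A ^+ 2 / (n.+1%:R * n`!%:R)) + (1 + d) * (B ^+ 2 / n`!%:R) =
   (d * n.+2%:R * A ^+ 2 + (1 + d) * (n.+1%:R * n.+2%:R) * B ^+ 2)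
     / (n.+2%:R * (n.+1%:R * n`!%:R)).
  by field; rewrite !gt_eqF.
rewrite ler_pM2r ?invr_gt0 ?mulr_gt0 //.
have := sqrD_le (- (n.+1%:R * B)) (x * A) d0; rewrite addrC => /le_trans; apply.
rewrite addrC lerD //.
  rewrite exprMn mulrA ler_wpM2r ?sqr_ge0 //; apply: le_trans h _.
  by rewrite mulrC ler_pM2l // ler_nat -addn2 leq_addr.
rewrite sqrrN exprMn [leLHS]mulrA ler_wpM2r ?sqr_ge0 // ler_pM2l; last by lra.
by rewrite expr2 ler_pM2l // ler_nat.
Qed.

(** One step of the recurrence [p'' = 2 c p' - (1 - e) p], written in terms of
    [p] and [u = p' - c p]: the form [u ^+ 2 + (1 - c ^+ 2) * p ^+ 2] is
    invariant when [e = 0]; as it degenerates for [c = 1] and [c = -1], the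
    term [d ^+ 2 * p ^+ 2] is added. *)
Lemma energy_step c u p e d : c ^+ 2 <= 1 -> 0 < d ->
  e ^+ 2 * (1 + d) <= d ^+ 4 ->
  (c * u + (c ^+ 2 - 1) * p + e * p) ^+ 2
     + (1 - c ^+ 2 + d ^+ 2) * (u + c * p) ^+ 2
  <= (1 + d) ^+ 2 * (u ^+ 2 + (1 - c ^+ 2 + d ^+ 2) * p ^+ 2).
Proof.
move=> c1 d0 e1; set A := c * u + (c ^+ 2 - 1) * p.
have h1 := sqrD_le A (e * p) d0.
have h2 := sqrD_le (c * p) u d0.
(* invariance of the quadratic form for e = 0 *)
have h3 : A ^+ 2 + (1 - c ^+ 2) * (u + c * p) ^+ 2 =
    u ^+ 2 + (1 - c ^+ 2) * p ^+ 2.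
  by rewrite /A; ring.
have h4 : (1 + d^-1) * (e * p) ^+ 2 <= d ^+ 3 * p ^+ 2.
  rewrite exprMn mulrA ler_wpM2r ?sqr_ge0 // -(ler_pM2l d0).
  have -> : d * ((1 + d^-1) * e ^+ 2) = e ^+ 2 * (1 + d) by field; rewrite gt_eqF.
  by rewrite -exprS.
have h5 : d ^+ 2 * (u + c * p) ^+ 2 <=
    d ^+ 2 * (1 + d) * p ^+ 2 + (d ^+ 2 + d) * u ^+ 2.
  have -> : d ^+ 2 * (1 + d) * p ^+ 2 + (d ^+ 2 + d) * u ^+ 2 =
     d ^+ 2 * ((1 + d) * p ^+ 2 + (1 + d^-1) * u ^+ 2) by field; rewrite gt_eqF.
  rewrite ler_pM2l ?exprn_gt0 // addrC; apply: le_trans h2 _.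
  rewrite lerD2r ler_pM2l; last lra.
  by rewrite exprMn ler_piMl ?sqr_ge0.
have h14 : (1 + d) * (A ^+ 2 + (1 - c ^+ 2) * (u + c * p) ^+ 2) =
  (1 + d) * (u ^+ 2 + (1 - c ^+ 2) * p ^+ 2) by rewrite h3.
(* h1, h4, h5 and h14 bound the left-hand side; the remaining facts are the
   signs of the terms of the slack *)
have h6 : 0 <= (1 - c ^+ 2) * (u + c * p) ^+ 2.
  by rewrite mulr_ge0 ?sqr_ge0 // subr_ge0.
have h7 : 0 <= (1 - c ^+ 2) * p ^+ 2 by rewrite mulr_ge0 ?sqr_ge0 // subr_ge0.
have h8 := mulr_ge0 (ltW d0) h6.
have h9 := mulr_ge0 (ltW d0) h7.
have h10 := mulr_ge0 (ltW d0) h9.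
have h11 : 0 <= d ^+ 4 * p ^+ 2 by rewrite mulr_ge0 ?sqr_ge0 // exprn_ge0 // ltW.
have h12 : 0 <= d ^+ 2 * p ^+ 2 by rewrite mulr_ge0 ?sqr_ge0.
have h13 : 0 <= d ^+ 3 * p ^+ 2 by rewrite mulr_ge0 ?sqr_ge0 // exprn_ge0 // ltW.
lra.
Qed.

Section AbsLtOne.
Variable q : R.
Hypothesis q1 : `|q| < 1.

Let qN1 : -1 < q. Proof. by move: q1; rewrite ltr_norml => /andP[]. Qed.
Let qlt1 : q < 1. Proof. by move: q1; rewrite ltr_norml => /andP[]. Qed.

Lemma qpoch_gt0 n : 0 < qpoch q q n.
Proof.
by rewrite qpoch_qfact mulr_gt0 ?exprn_gt0 ?subr_gt0 // qfact_gt0.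
Qed.

Lemma inv_qpoch_subexp : subexp (fun n => (qpoch q q n)^-1).
Proof.
apply: subexp_ratio => [n|s s1]; first by rewrite invr_ge0 ltW // qpoch_gt0.
have s0 : 0 < s by exact: lt_trans s1.
have [N Nh] : exists N, forall n, (N <= n)%N -> `|q| ^+ n <= 1 - s^-1.
  by apply: cvg_expr_near => //; rewrite subr_gt0 invf_lt1.
exists N => n Nn; have := Nh n.+1 (leqW Nn); rewrite -normrX => h.
have {}h : q ^+ n.+1 <= 1 - s^-1 by exact: le_trans (ler_norm _) h.
rewrite qpochS -exprS invfM mulrC ler_wpM2r ?invr_ge0 ?(ltW (qpoch_gt0 _)) //.
have i0 : 0 < s^-1 by rewrite invr_gt0.
by rewrite -[s]invrK lef_pV2 ?posrE //; lra.
Qed.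

(** With [a = sqrt (1 - q)], the polynomials [a ^+ n * H_n] satisfy the
    recurrence of [energy_step] for [2 * c = a * x] and [e = q ^+ n.+1];
    membership of [x] in [S(q)] means that [-1 <= c <= 1]. *)
Lemma sqr_qHermite_subexp x : qsupport q x ->
  subexp (fun n => qHermite q n x ^+ 2 / qfact q n).
Proof.
rewrite /qsupport /= lt_eqF //= in_itv /= => /andP[xl xr].
pose a := Num.sqrt (1 - q).
have a0 : 0 < a by rewrite sqrtr_gt0 subr_gt0.
have a2 : a ^+ 2 = 1 - q by rewrite sqr_sqrtr // subr_ge0 ltW.
pose c := x * a / 2.
have c1 : c ^+ 2 <= 1.
  move: xl xr; rewrite -/a -mulNr ler_pdivrMr // ler_pdivlMr // => xl xr.
  have -> : c ^+ 2 = 1 - (1 - c) * (1 + c) by ring.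
  by rewrite gerBl mulr_ge0 // /c; lra.
pose p n := a ^+ n * qHermite q n x.
have pS n : p n.+2 = 2 * c * p n.+1 - (1 - q ^+ n.+1) * p n.
  by rewrite /p qHermiteS -subr1_qnum -a2 /c !exprS; field.
have psub : subexp (fun n => p n ^+ 2).
  move=> s s1; pose d := Num.sqrt s - 1.
  have t1 : 1 < Num.sqrt s by rewrite -sqrtr1 ltr_sqrt // (lt_trans _ s1).
  have d0 : 0 < d by rewrite /d; lra.
  have sd : (1 + d) ^+ 2 = s.
    by rewrite /d addrC subrK sqr_sqrtr // ltW // (lt_trans _ s1).
  (* d is chosen so that one energy step costs the factor (1 + d) ^+ 2 = s *)
  pose W n := (p n.+1 - c * p n) ^+ 2 + (1 - c ^+ 2 + d ^+ 2) * p n ^+ 2.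
  have k0 : 0 <= 1 - c ^+ 2 by rewrite subr_ge0.
  have W0 n : 0 <= W n.
    by rewrite /W addr_ge0 ?sqr_ge0 // mulr_ge0 ?sqr_ge0 // addr_ge0 ?sqr_ge0.
  have d10 : 0 < 1 + d by lra.
  have [N Nh] := cvg_expr_near q1 (divr_gt0 (exprn_gt0 4 d0) d10).
  have s0 : 0 < s by exact: lt_trans s1.
  have [|C WC] := bound_of_ratio s0 W0.
    exists N => n Nn; have := Nh n.+1 (leqW Nn).
    rewrite ler_pdivlMr // -normrX => h.
    have e1 : (q ^+ n.+1) ^+ 2 * (1 + d) <= d ^+ 4.
      apply: le_trans h; rewrite ler_pM2r // -real_normK ?num_real // expr2.
      by rewrite ler_piMl // normrX exprn_ile1 // ltW.
    have := energy_step (p n.+1 - c * p n) (p n) c1 d0 e1.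
    rewrite sd /W pS; apply: le_trans; rewrite le_eqVlt; apply/orP; left.
    by apply/eqP; ring.
  exists (C / d ^+ 2) => n; rewrite ger0_norm ?sqr_ge0 // mulrAC.
  rewrite ler_pdivlMr ?exprn_gt0 //; apply: le_trans (WC n); rewrite /W.
  rewrite [leLHS]mulrC [(_ + _) * p n ^+ 2]mulrDl addrA lerDr.
  by rewrite addr_ge0 ?sqr_ge0 // mulr_ge0 ?sqr_ge0.
apply: subexp_le (subexpM psub inv_qpoch_subexp) => n.
rewrite /p qpoch_qfact -a2 exprMn -!exprM mulnC le_eqVlt; apply/orP; left.
apply/eqP; congr (`|_|); field.
by rewrite expf_neq0 ?gt_eqF // qfact_gt0.
Qed.

End AbsLtOne.

Section Products.
Variable q : R.
Hypothesis qN1 : -1 < q.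
Hypothesis q1 : q <= 1.

Lemma sqr_qHermite_shift_subexp x i :
  subexp (fun n => qHermite q n x ^+ 2 / qfact q n) ->
  subexp (fun n => qHermite q (n + i) x ^+ 2 / qfact q n).
Proof.
move=> h; elim: i => [|i IH]; first by under eq_fun do rewrite addn0.
apply: subexp_le (subexpM (subexpS IH) subexp_natS) => n.
have f0 := qfact_gt0 qN1 n; have g0 := qnum_gt0 qN1 n.
rewrite addSnnS; set H := qHermite _ _ _.
have -> : H ^+ 2 / qfact q n.+1 * n.+1%:R =
          H ^+ 2 / qfact q n * (n.+1%:R / qnum q n.+1).
  by rewrite qfactS; field; rewrite !gt_eqF.
rewrite [leRHS]normrM ler_peMr // ger0_norm ?divr_ge0 ?(ltW g0) //.
by rewrite ler_pdivlMr // mul1r qnum_le.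
Qed.

Lemma qHermite_prod_subexp x y i j :
  subexp (fun n => qHermite q n x ^+ 2 / qfact q n) ->
  subexp (fun n => qHermite q n y ^+ 2 / qfact q n) ->
  subexp (fun n => qHermite q (n + i) x * qHermite q (n + j) y / qfact q n).
Proof.
move=> hx hy.
apply: subexp_le (subexpD (sqr_qHermite_shift_subexp i hx)
                          (sqr_qHermite_shift_subexp j hy)) => n.
rewrite -mulrDl normrM [in leRHS]normrM ler_wpM2r //.
set a := qHermite _ _ _; set b := qHermite _ _ _.
rewrite (ger0_norm (addr_ge0 (sqr_ge0 a) (sqr_ge0 b))) ler_norml.
have := sqr_ge0 (a - b); have := sqr_ge0 (a + b) => h1 h2.
by apply/andP; split; nra.
Qed.

End Products.
End Growth.

(** * The kernels gamma_{i,j} and the rational functions Q_{i,j} *)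

Section KernelRecurrence.
Context {R : realType}.
Variables q rho x y : R.
Hypothesis qN1 : -1 < q.
Implicit Types (i j k n s K N : nat).

(** The coefficient of [rho ^+ n] in [gamma_{i,j}]. *)
Definition kernel_coeff i j n : R :=
  qHermite q (n + i) x * qHermite q (n + j) y / qfact q n.

Definition kernel_term i j n : R := rho ^+ n * kernel_coeff i j n.

(** The sum [gamma_{i,j}] of the series; it is meaningful only when the series
    converges. *)
Definition kernel i j : R := limn (series (kernel_term i j)).

(* The coefficients of the explicit formula for Q_{i,j}; they vanish for s > j,
   so that sums over s may run up to any larger bound. *)
Let c j s : R :=
  (-1) ^+ s * q ^+ 'C(s, 2) * qbinom q j s * rho ^+ s * qHermite q (j - s) y.

Let c_gt j s : (j < s)%N -> c j s = 0.
Proof. by move=> js; rewrite /c qbinom_gt // mulr0 !mul0r. Qed.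

Let cS0 j : c j.+1 0 = y * c j 0 - qnum q j * c j.-1 0.
Proof.
by rewrite /c !qbinom0 // !subn0 bin0n !expr0 !mul1r qHermite_rec.
Qed.

Let cSS j s : c j.+1 s.+1 =
  y * c j s.+1 - qnum q j * c j.-1 s.+1 - q ^+ j * rho * c j s.
Proof.
have [js|sj] := ltnP j s.
  by rewrite !c_gt ?mulr0 ?subr0 //; lia.
have e1 : q ^+ 'C(s.+1, 2) * q ^+ (j - s) = q ^+ 'C(s, 2) * q ^+ j.
  by rewrite -!exprD; congr (q ^+ _); rewrite binS bin1; lia.
have main : qbinom q j s.+1 * qHermite q (j - s) y =
    y * (qbinom q j s.+1 * qHermite q (j - s.+1) y)
    - qnum q j * (qbinom q j.-1 s.+1 * qHermite q (j.-1 - s.+1) y).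
  have [e|sltj] := eqVneq s j.
    by rewrite !qbinom_gt ?mul0r ?mulr0 ?subr0 //; lia.
  have [j' jE] : exists j', j = j'.+1 by exists j.-1; lia.
  subst j; rewrite -subnSK; last by lia.
  rewrite qHermite_rec /= [qnum q j'.+1 * (_ * _)]mulrA -qnum_qbinom //.
  by rewrite (_ : (_ - _).-1 = j' - s.+1)%N; [ring | lia].
rewrite /c subSS qbinomS' //.
transitivity ((-1) ^+ s.+1 * rho ^+ s.+1 *
  ((q ^+ 'C(s.+1, 2) * q ^+ (j - s)) * (qbinom q j s * qHermite q (j - s) y)
   + q ^+ 'C(s.+1, 2) * (qbinom q j s.+1 * qHermite q (j - s) y))).
  by ring.
by rewrite e1 main !exprS; ring.
Qed.

(** The recurrence in [j] determines a two-index family from its values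
    at [j = 0]. *)
Lemma kernel_rec_solution (g : nat -> nat -> R) :
  (forall i j, g i j.+1 =
     y * g i j - qnum q j * g i j.-1 - q ^+ j * rho * g i.+1 j) ->
  forall i j, g i j =
    \sum_(s < j.+1) (-1) ^+ s * q ^+ 'C(s, 2) * qbinom q j s * rho ^+ s
       * qHermite q (j - s) y * g (i + s)%N 0.
Proof.
move=> gS.
pose S j M i := \sum_(s < M) c j s * g (i + s)%N 0.
have SM j M i : (j < M)%N -> S j M i = S j j.+1 i.
  move=> jM; rewrite /S (big_ord_widen M (fun s => c j s * g (i + s)%N 0) jM).
  rewrite [RHS]big_mkcond; apply: eq_bigr => s _.
  by case: ltnP => // js; rewrite c_gt ?mul0r.
have SS j M i : S j.+1 M.+1 i =
    y * S j M.+1 i - qnum q j * S j.-1 M.+1 i - q ^+ j * rho * S j M i.+1.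
  have -> : S j M i.+1 = \sum_(s < M) c j s * g (i + s.+1)%N 0.
    by apply: eq_bigr => s _; rewrite addSnnS.
  have SE k : S k M.+1 i =
      c k 0 * g i 0 + \sum_(s < M) c k s.+1 * g (i + s.+1)%N 0.
    by rewrite /S big_ord_recl addn0.
  rewrite !SE cS0; have -> : \sum_(s < M) c j.+1 s.+1 * g (i + s.+1)%N 0 =
      y * (\sum_(s < M) c j s.+1 * g (i + s.+1)%N 0)
      - qnum q j * (\sum_(s < M) c j.-1 s.+1 * g (i + s.+1)%N 0)
      - q ^+ j * rho * \sum_(s < M) c j s * g (i + s.+1)%N 0.
    by rewrite !mulr_sumr -!sumrB; apply: eq_bigr => s _; rewrite cSS; ring.
  by ring.
suff both j i : g i j = S j j.+1 i /\ g i j.+1 = S j.+1 j.+2 i.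
  by move=> i j; have [-> _] := both j i.
elim: j i => [|j IH] i.
  have g0 k : g k 0 = S 0 1 k.
    by rewrite /S big_ord1 /c qbinom0 // addn0 bin0n !expr0 !mul1r.
  split=> //; rewrite gS SS (SM 0 2) //= qnum0 !mul0r !subr0.
  by rewrite -!g0.
have [h1 h2] := IH i; split=> //.
rewrite gS SS (SM j.+1 j.+3) // (SM j j.+3 _ (leqW (leqnSn _))) /=.
by rewrite -h1 -h2; have [_ <-] := IH i.+1.
Qed.

Hypothesis cvg_kernel : forall i j, cvgn (series (kernel_term i j)).

Lemma hassum_kernel i j : hassum (kernel_term i j) (kernel i j).
Proof. exact: cvg_hassum. Qed.

(** The recurrence of [H_{n+i+1}(x)] summed over [n]. As
    [[n+i]_q = [i]_q + q ^+ i * [n]_q], its last term splits into a multiple of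
    [gamma_{i-1,j}] and, [[n]_q] cancelling against [[n]_q!], the delayed series
    of [gamma_{i,j+1}]. *)
Lemma kernel_Sl i j : kernel i.+1 j =
  x * kernel i j - qnum q i * kernel i.-1 j - q ^+ i * rho * kernel i j.+1.
Proof.
refine (hassum_unique (hassum_kernel i.+1 j) _).
apply: (eq_hassum (hassumB (hassumB (hassumZ x (hassum_kernel i j))
  (hassumZ (qnum q i) (hassum_kernel i.-1 j)))
  (hassumZ (q ^+ i * rho) (hassum_delay (hassum_kernel i j.+1))))).
case=> [|n]; rewrite [delay _ _]/= /kernel_term /kernel_coeff.
  by rewrite !add0n qfact0 qHermite_rec; field.
have e1 : qHermite q (n.+1 + i.+1) x = x * qHermite q (n.+1 + i) x
    - (qnum q i + q ^+ i * qnum q n.+1) * qHermite q (n + i) x.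
  by rewrite addnS qHermite_rec -qnumD (addnC i).
have e2 : qnum q i * qHermite q (n.+1 + i.-1) x =
          qnum q i * qHermite q (n + i) x.
  case: i {e1} => [|i]; first by rewrite qnum0 !mul0r.
  by rewrite [i.+1.-1]/= addSnnS.
rewrite e1 -addSnnS qfactS exprS.
transitivity (x * (rho * rho ^+ n * (qHermite q (n.+1 + i) x *
    qHermite q (n.+1 + j) y / (qfact q n * qnum q n.+1))) -
  (qnum q i * qHermite q (n.+1 + i.-1) x) * (rho * rho ^+ n *
    (qHermite q (n.+1 + j) y / (qfact q n * qnum q n.+1))) -
  q ^+ i * rho * (rho ^+ n * (qHermite q (n + i) x *
    qHermite q (n.+1 + j) y / qfact q n))); first by ring.
rewrite e2; field.
by rewrite qfact_neq0 // qnum_neq0.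
Qed.

End KernelRecurrence.

Lemma kernel_termC {R : realType} (q rho x y : R) i j :
  kernel_term q rho x y i j = kernel_term q rho y x j i.
Proof.
apply/funext => n; rewrite /kernel_term /kernel_coeff.
by rewrite [qHermite _ (n + i) _ * _]mulrC.
Qed.

Lemma kernelC {R : realType} (q rho x y : R) i j :
  kernel q rho x y i j = kernel q rho y x j i.
Proof. by rewrite /kernel kernel_termC. Qed.

Section Kernel.
Context {R : realType}.
Variables q rho x y : R.
Hypothesis qN1 : -1 < q.
Hypothesis q1 : q <= 1.
Hypothesis rho1 : `|rho| < 1.
Hypothesis cvg_kernel : forall i j, cvgn (series (kernel_term q rho x y i j)).
Implicit Types (i j k n s K N : nat).

Local Notation t := (kernel_term q rho x y).
Local Notation gam := (kernel q rho x y).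

Lemma kernel_Sr i j : gam i j.+1 =
  y * gam i j - qnum q j * gam i j.-1 - q ^+ j * rho * gam i.+1 j.
Proof.
have cvgC i' j' : cvgn (series (kernel_term q rho y x i' j')).
  by rewrite kernel_termC.
by rewrite kernelC (kernel_Sl qN1 cvgC) !(kernelC _ _ y x).
Qed.

Lemma qpoch_neq0 i : qpoch (rho ^+ 2) q i != 0.
Proof.
rewrite /qpoch; apply/prodf_neq0 => k _; rewrite gt_eqF // subr_gt0.
apply: le_lt_trans (ler_norm _) _; rewrite normrM !normrX.
apply: (@le_lt_trans _ _ (`|rho| ^+ 2)); last by rewrite exprn_ilt1.
by rewrite ler_piMr ?exprn_ge0 // exprn_ile1 // ler_norml q1 ltW.
Qed.

(** Eliminating [gamma_{k,1}] between [kernel_Sl] and [kernel_Sr] at [j = 0]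
    gives the recurrence of the Al-Salam-Chihara polynomials. *)
Lemma kernel_i0 i : gam i 0 =
  AlSalamChihara q rho y i x / qpoch (rho ^+ 2) q i * gam 0 0.
Proof.
have h k : (1 - rho ^+ 2 * q ^+ k) * gam k.+1 0 =
    (x - rho * y * q ^+ k) * gam k 0 - qnum q k * gam k.-1 0.
  have := kernel_Sr k 0; rewrite qnum0 mul0r subr0 expr0 mul1r.
  have := kernel_Sl qN1 cvg_kernel k 0 => h1 h2; rewrite h2 in h1.
  by rewrite {1}mulrBl {1}h1; ring.
suff both : gam i 0 =
      AlSalamChihara q rho y i x / qpoch (rho ^+ 2) q i * gam 0 0 /\
    gam i.+1 0 =
      AlSalamChihara q rho y i.+1 x / qpoch (rho ^+ 2) q i.+1 * gam 0 0.
  by case: both.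
have nz k : 1 - rho ^+ 2 * q ^+ k != 0.
  by have := qpoch_neq0 k.+1; rewrite qpochS mulf_eq0 negb_or => /andP[].
elim: i => [|i [IH1 IH2]].
  rewrite qpochS qpoch0 /= invr1 !mul1r; split=> //.
  apply: (mulfI (nz 0)); rewrite h qnum0 expr0 !mulr1; field.
  by have := nz 0; rewrite expr0 mulr1.
split=> //; apply: (mulfI (nz i.+1)); rewrite h /= IH1 IH2.
rewrite !qpochS -/(AlSalamChihara q rho y i.+1 x); field.
by rewrite !nz qpoch_neq0.
Qed.

Lemma kernel_Qpoly i j : gam i j = Qpoly q rho i j x y * gam 0 0.
Proof.
rewrite (kernel_rec_solution qN1 kernel_Sr) /Qpoly mulr_suml.
by apply: eq_bigr => s _; rewrite (kernel_i0 (i + s)) !mulrA.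
Qed.

(** Substitution of [N = n + k] in the series of [gamma_{i+k,j+k}]. *)
Lemma hassum_qbinom_kernel i j k :
  hassum (fun N => qbinom q N k * t i j N)
         (rho ^+ k / qfact q k * gam (i + k) (j + k)).
Proof.
apply: (@hassum_shiftn _ k) => [n nk|]; first by rewrite qbinom_gt ?mul0r.
apply: (eq_hassum (hassumZ (rho ^+ k / qfact q k)
                     (hassum_kernel cvg_kernel (i + k) (j + k)))) => n.
rewrite qbinomE ?leq_addl // addnK /kernel_term /kernel_coeff.
rewrite exprD !(addnAC n k) !addnA; field.
by rewrite !qfact_neq0.
Qed.

(** Recovery of [H_i(x) * H_j(y)] from the [gamma_{i+k,j+k}], given a dominating
    sequence [B], independent of [K], for the weights of the remainders. *)
Lemma alternating_kernel_sum (B : nat -> R) i j :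
  (forall K N, `|q ^+ 'C(K.+1, 2) * qbinom q N K| <= B N) ->
  cvgn (series (fun N => `|B N * t i j N.+1|)) ->
  hassum (fun k => (-1) ^+ k * q ^+ 'C(k, 2)
                     * (rho ^+ k / qfact q k * gam (i + k) (j + k)))
         (qHermite q i x * qHermite q j y).
Proof.
move=> hB cB; set u := fun k => _; set l := _ * _.
pose b := delay (fun N => `|B N * t i j N.+1|).
have bS := hassum_delay (cvg_hassum cB); rewrite -/b in bS.
set T := limn _ in bS.
have l0 : t i j 0 = l.
  by rewrite /kernel_term /kernel_coeff qfact0 expr0 mul1r divr1.
have bd K : `|series u K.+1 - l| <= T - series b K.
  have h1 : hassum (fun N => (\sum_(k < K.+1) (-1) ^+ k * q ^+ 'C(k, 2)
                                * qbinom q N k) * t i j N)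
                   (series u K.+1).
    rewrite /series /= big_mkord.
    apply: (eq_hassum (@hassum_sum _ K.+1 (fun k N => (-1) ^+ k * q ^+ 'C(k, 2)
              * (qbinom q N k * t i j N)) u _)) => [k _|N].
      exact: hassumZ (hassum_qbinom_kernel i j k).
    by rewrite mulr_suml; apply: eq_bigr => k _; rewrite mulrA.
  (* the remainder: its N-th term vanishes for 0 <= N <= K *)
  have h2 : hassum (delay (fun N => (-1) ^+ K * q ^+ 'C(K.+1, 2) * qbinom q N K
                          * t i j N.+1)) (series u K.+1 - l).
    apply: (eq_hassum (hassumB h1 (hassum_head l))); case=> [|N] /=.
      by rewrite sum_alt_qbinom0 // mul1r l0 subrr.
    by rewrite sum_alt_qbinom // subr0.
  apply: (hassum_norm_le h2 (hassum_tail K bS)); case=> [|N] /=.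
    by rewrite normr0; case: ifP.
  have [NK|KN] := ltnP N.+1 K.
    by rewrite qbinom_gt ?mulr0 ?mul0r ?normr0 // ltnW.
  rewrite !normrM normrX normrN1 expr1n mul1r -normrM ler_wpM2r //.
  exact: le_trans (hB K N) (ler_norm _).
apply/hassumP; rewrite -(cvg_shiftS _); apply/cvgrPdist_le => e e0.
have /hassumP/cvgrPdist_le/(_ e e0)[N _ Nh] := bS.
exists N => // K NK /=; rewrite distrC; apply: le_trans (bd K) _.
exact: le_trans (ler_norm _) (Nh K NK).
Qed.

End Kernel.

(** * Infinite products: the formulas of Euler and Poisson-Mehler *)

Section InfiniteProducts.
Context {R : realType}.
Variable q : R.
Hypothesis q1 : `|q| < 1.
Implicit Types (a x y z rho : R) (m n : nat).

Let qN1 : -1 < q. Proof. by move: q1; rewrite ltr_norml => /andP[]. Qed.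
Let qlt1 : q < 1. Proof. by move: q1; rewrite ltr_norml => /andP[]. Qed.

Lemma norm_mulX_lt1 a m : `|a| < 1 -> `|a * q ^+ m| < 1.
Proof.
move=> a1; rewrite normrM normrX; apply: le_lt_trans a1.
by rewrite ler_piMr // exprn_ile1 // ltW.
Qed.

(** Euler's argument: the sum [F(z)] of the series [z ^+ n / (q;q)_n] satisfies
    [F(z * q) = (1 - z) * F(z)], so [(a;q)_m * F(a) = F(a * q ^+ m)] tends to 1.
    Hence [F(a)] is nonzero and [(a;q)_m] tends to its inverse. *)
Lemma qpoch_cvg a : `|a| < 1 ->
  exists2 l : R, qpoch a q @ \oo --> l & l != 0.
Proof.
move=> a1; pose c n := (qpoch q q n)^-1.
pose e z n := z ^+ n * c n.
have cs : subexp c by exact: inv_qpoch_subexp.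
have eS z : `|z| < 1 -> hassum (e z) (limn (series (e z))).
  by move=> z1; apply/cvg_hassum/cvg_series_norm; exact: subexp_cvg cs z1.
have step z : `|z| < 1 ->
    limn (series (e (z * q))) = (1 - z) * limn (series (e z)).
  move=> z1; have z2 : `|z * q| < 1 by rewrite -[q]expr1 norm_mulX_lt1.
  apply: (hassum_unique (eS _ z2)); rewrite mulrBl mul1r.
  apply: (eq_hassum (hassumB (eS _ z1) (hassumZ z (hassum_delay (eS _ z1))))).
  case=> [|n]; first by rewrite /e !expr0 mulr0 subr0.
  rewrite [delay _ _]/= /e /c qpochS exprMn !exprS; field.
  have := qpoch_gt0 q1 n.+1; have := qpoch_gt0 q1 n.
  by rewrite qpochS => h1; rewrite pmulr_rgt0 // => h2; rewrite !gt_eqF.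
pose f m := limn (series (e (a * q ^+ m))).
have fS m : f m.+1 = (1 - a * q ^+ m) * f m.
  by rewrite /f exprSr mulrA step // norm_mulX_lt1.
have fE m : qpoch a q m * f 0 = f m.
  elim: m => [|m IH]; first by rewrite qpoch0 mul1r.
  by rewrite qpochS mulrAC IH fS mulrC.
have f1 : f @ \oo --> (1 : R).
  rewrite (_ : 1 = c 0); last by rewrite /c qpoch0 invr1.
  apply: (power_series_cvg0 q1 (subexp_cvg cs a1)) => m.
  exact: eS (norm_mulX_lt1 m a1).
have f0 : f 0 != 0.
  apply/eqP => f00; move/eqP: (oner_neq0 R); apply.
  rewrite -(cvg_lim (@Rhausdorff R) f1) (_ : f = fun=> 0) ?lim_cst //.
  by apply/funext => m; rewrite -fE f00 mulr0.
exists (f 0)^-1; last by rewrite invr_eq0.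
rewrite (_ : qpoch a q = fun m => f m * (f 0)^-1).
  by rewrite -[X in _ --> X]mul1r; apply: cvgM; [exact: f1 | exact: cvg_cst].
by apply/funext => m; rewrite -fE mulfK.
Qed.

Lemma qbinom_bounded : exists C : R, forall n k, `|qbinom q n k| <= C.
Proof.
have [l ql l0] := qpoch_cvg q1.
have ub (u : nat -> R) : cvgn u -> exists2 M : R, 0 <= M & forall n, `|u n| <= M.
  move=> /cvg_has_ub[M Mub]; exists `|M| => // n.
  by apply: le_trans (ler_norm M); apply: Mub; exists n.
have [|M M0 Mh] := ub (qpoch q q); first by apply/cvg_ex; exists l.
have [|D D0 Dh] := ub (fun n => (qpoch q q n)^-1).
  by apply/cvg_ex; exists l^-1; exact: cvgV.
exists (M * (D * D)) => n k; have [nk|kn] := ltnP n k.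
  by rewrite qbinom_gt // normr0 !mulr_ge0.
have -> : qbinom q n k =
    qpoch q q n * ((qpoch q q (n - k))^-1 * (qpoch q q k)^-1).
  rewrite qbinomE // !qpoch_qfact.
  have -> : (1 - q) ^+ n = (1 - q) ^+ (n - k) * (1 - q) ^+ k.
    by rewrite -exprD subnK.
  field.
  have q0 : 1 - q != 0 by rewrite gt_eqF // subr_gt0.
  by rewrite !qfact_neq0 // !expf_neq0.
by rewrite !normrM; apply: ler_pM => //; apply: ler_pM.
Qed.

Section PoissonMehler.
Variables x y : R.
Hypothesis kernel_subexp : subexp (kernel_coeff q x y 0 0).

Local Notation gam z := (kernel q z x y 0 0).
Local Notation X := (x * Num.sqrt (1 - q) / 2).
Local Notation Y := (y * Num.sqrt (1 - q) / 2).

Let gamS z : `|z| < 1 -> hassum (kernel_term q z x y 0 0) (gam z).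
Proof.
by move=> z1; apply/cvg_hassum/cvg_series_norm; exact: subexp_cvg kernel_subexp z1.
Qed.

(** Both sides are power series in [z]; the coefficients agree because the
    products [H_n(x) * H_n(y)] satisfy a linear recurrence of order 4. *)
Lemma poisson_mehler_step z : `|z| < 1 ->
  gam z * omega X Y z = (1 - z ^+ 2) * (1 - z ^+ 2 * q) * gam (z * q).
Proof.
move=> z1; have z2 : `|z * q| < 1 by rewrite -[q]expr1 norm_mulX_lt1.
have a2 : Num.sqrt (1 - q) ^+ 2 = 1 - q by rewrite sqr_sqrtr // subr_ge0 ltW.
have g1 := gamS z1; have g2 := gamS z2.
have d1 := hassum_delay g1; have d2 := hassum_delay d1.
have d3 := hassum_delay d2; have d4 := hassum_delay d3.
have k2 := hassum_delay (hassum_delay g2).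
have k4 := hassum_delay (hassum_delay k2).
pose A := z * (1 - q) * x * y.
pose B := z ^+ 2 * ((1 - q) * (x ^+ 2 + y ^+ 2) - 2).
have -> : gam z * omega X Y z =
    gam z - A * gam z + B * gam z - z ^+ 2 * A * gam z + z ^+ 4 * gam z.
  rewrite /omega /A /B; set s := Num.sqrt _ in a2 *.
  by rewrite -a2; field.
have -> : (1 - z ^+ 2) * (1 - z ^+ 2 * q) * gam (z * q) =
  gam (z * q) - z ^+ 2 * (1 + q) * gam (z * q) + z ^+ 4 * q * gam (z * q) by ring.
apply: (hassum_unique (hassumD (hassumB (hassumD (hassumB g1 (hassumZ A d1))
  (hassumZ B d2)) (hassumZ (z ^+ 2 * A) d3)) (hassumZ (z ^+ 4) d4))).
apply: (eq_hassum (hassumD (hassumB g2 (hassumZ (z ^+ 2 * (1 + q)) k2))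
  (hassumZ (z ^+ 4 * q) k4))) => n.
rewrite /kernel_term /kernel_coeff /A /B.
have qn (k : nat) : q ^+ k.+1 = 1 - (1 - q) * qnum q k.+1.
  by rewrite subr1_qnum; ring.
have qs (k : nat) : qnum q k.+2 = 1 + q * qnum q k.+1.
  by rewrite -addn1 addnC qnumD expr1 /qnum big_ord1.
have qnum1 : qnum q 1 = 1 by rewrite /qnum big_ord1 expr0.
have n0 (k : nat) := qnum_neq0 qN1 k.
(* the delayed sequences start with zeros, so the first four coefficients
   are checked separately *)
case: n => [|[|[|[|n]]]].
- by rewrite /= qfact0 !expr0; ring.
- by rewrite /= !qfactS qfact0 qnum1 !expr0 !expr1; field.
- rewrite /= !qfactS qfact0 qnum1 qs qnum1 !mulr1; field.
  by have := n0 1; rewrite qs qnum1 mulr1.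
- rewrite /= !qfactS qfact0 !(qs, qnum1) !mulr1; field.
  by have := n0 2; have := n0 1; rewrite !(qs, qnum1) !mulr1 => -> ->.
(* q ^+ n enters only through q * q ^+ n, a polynomial in q and [n+1]_q *)
have e : q * q ^+ n = 1 - (1 - q) * qnum q n.+1 by rewrite -exprS.
have f0 := qfact_neq0 qN1 n.
have n1 := n0 n; have n2 := n0 n.+1; have n3 := n0 n.+2; have n4 := n0 n.+3.
rewrite /delay !addn0 !exprMn.
set h0 := _ / qfact q n; set h1 := _ / qfact q n.+1.
set h2 := _ / qfact q n.+2; set h3 := _ / qfact q n.+3.
set h4 := _ / qfact q n.+4.
transitivity (z ^+ n * z ^+ 4 * (q ^+ 3 * (q * q ^+ n) * h4
    - (1 + q) * (q * (q * q ^+ n)) * h2 + (q * q ^+ n) * h0)).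
  by rewrite !exprS; ring.
transitivity (z ^+ n * z ^+ 4 * (h4 - (1 - q) * x * y * h3
  + ((1 - q) * (x ^+ 2 + y ^+ 2) - 2) * h2 - (1 - q) * x * y * h1 + h0)); last first.
  by rewrite !exprS; ring.
congr (_ * _); rewrite e /h0 /h1 /h2 /h3 /h4 !qHermiteS !qfactS.
move: n2 n3 n4; rewrite !qs.
set k := qnum q n.+1 in n1 *; set F := qfact q n in f0 *.
set A0 := qHermite q n x; set A1 := qHermite q n.+1 x.
set B0 := qHermite q n y; set B1 := qHermite q n.+1 y => n2 n3 n4.
field.
by rewrite n1 n2 n3 n4 f0.
Qed.

(** The Poisson-Mehler formula, with the infinite product on the left-hand side
    so that its convergence need not be known beforehand. *)
Lemma poisson_mehler rho (l : R) : `|rho| < 1 ->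
  qpoch (rho ^+ 2) q @ \oo --> l ->
  (fun m => gam rho * omega_prod q rho x y m) @ \oo --> l.
Proof.
move=> rho1 ql.
have E m : gam rho * omega_prod q rho x y m =
    qpoch (rho ^+ 2) q m.*2 * gam (rho * q ^+ m).
  elim: m => [|m IH].
    by rewrite /omega_prod big_ord0 qpoch0 expr0 !mulr1 mul1r.
  rewrite /omega_prod big_ord_recr /= mulrA -/(omega_prod q rho x y m) IH.
  rewrite -mulrA poisson_mehler_step ?norm_mulX_lt1 // doubleS !qpochS.
  have -> : rho * q ^+ m * q = rho * q ^+ m.+1 by rewrite exprSr mulrA.
  by rewrite (exprSr q m.*2) -muln2 exprM; ring.
rewrite (funext E) -[l]mulr1; apply: cvgM.
  apply/cvgrPdist_le => e e0; have /cvgrPdist_le/(_ e e0)[N _ Nh] := ql.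
  by exists N => // m Nm; apply: Nh; rewrite /= -addnn (leq_trans Nm) ?leq_addr.
have c0 : kernel_coeff q x y 0 0 0 = 1.
  by rewrite /kernel_coeff qfact0 divr1 /= mulr1.
rewrite -c0; apply: (power_series_cvg0 q1 (subexp_cvg kernel_subexp rho1)) => m.
exact: gamS (norm_mulX_lt1 m rho1).
Qed.

End PoissonMehler.
End InfiniteProducts.

(** * The expansions of the reciprocal of the kernel *)

Section Reciprocal.
Context {R : realType}.
Variables q rho x y : R.
Hypothesis qN1 : -1 < q.
Hypothesis q1 : q <= 1.
Hypothesis rho1 : `|rho| < 1.
Hypothesis subx : subexp (fun n => qHermite q n x ^+ 2 / qfact q n).
Hypothesis suby : subexp (fun n => qHermite q n y ^+ 2 / qfact q n).

Let coeff_subexp i j : subexp (kernel_coeff q x y i j).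
Proof. exact: qHermite_prod_subexp. Qed.

Lemma kernel_cvg i j : cvgn (series (kernel_term q rho x y i j)).
Proof. by apply: cvg_series_norm; exact: subexp_cvg (coeff_subexp i j) rho1. Qed.

(** Here [r] bounds the exponential growth rate of the q-binomial coefficients:
    [r = 1] will serve for [|q| < 1] and [r = 2] for [q = 1]. *)
Lemma alternating_Qpoly_sum (C r : R) : `|r * rho| < 1 ->
  (forall K N, `|q ^+ 'C(K.+1, 2) * qbinom q N K| <= C * r ^+ N) ->
  kernel q rho x y 0 0 != 0 /\
  forall i j, hassum (fun k => (-1) ^+ k * q ^+ 'C(k, 2) * (rho ^+ k / qfact q k)
                        * Qpoly q rho (i + k) (j + k) x y)
    (qHermite q i x * qHermite q j y / kernel q rho x y 0 0).
Proof.
move=> rrho hB.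
have h i j : hassum (fun k => kernel q rho x y 0 0 *
     ((-1) ^+ k * q ^+ 'C(k, 2) * (rho ^+ k / qfact q k)
       * Qpoly q rho (i + k) (j + k) x y)) (qHermite q i x * qHermite q j y).
  apply: (eq_hassum (alternating_kernel_sum qN1 kernel_cvg hB _)) => [|k].
    have cs : subexp (fun N => C * rho * kernel_coeff q x y i j N.+1).
      apply: (subexpM _ (subexpS (coeff_subexp i j))).
      exact: (@subexp_bounded _ _ `|C * rho|).
    rewrite (_ : (fun N => _) = fun N =>
      `|(r * rho) ^+ N * (C * rho * kernel_coeff q x y i j N.+1)|).
      exact: subexp_cvg cs rrho.
    apply/funext => N.
    by rewrite /kernel_term exprMn exprS; congr (`|_|); ring.
  by rewrite (kernel_Qpoly qN1 q1 rho1 kernel_cvg (i + k)); ring.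
(* for i = j = 0, a multiple of gamma_{0,0} has the sum 1 *)
have g0 : kernel q rho x y 0 0 != 0.
  apply/eqP => g0; have h0 := h 0 0; rewrite g0 in h0.
  have h1 := hassumZ 0 h0; rewrite mul0r in h1.
  have /eqP := hassum_unique h0
    (eq_hassum h1 (fun k => etrans (mul0r _) (esym (mul0r _)))).
  by rewrite /= mulr1 oner_eq0.
split=> // i j; rewrite mulrC.
by apply: (eq_hassum (hassumZ _ (h i j))) => k; rewrite mulKf.
Qed.

End Reciprocal.

Theorem theorem1 (R : realType) :
  (forall q rho x y : R,
     `|q| < 1 -> `|rho| < 1 -> qsupport q x -> qsupport q y ->
     [/\ (* the infinite products make sense *)
         cvgn (omega_prod q rho x y),
         cvgn (qpoch (rho ^+ 2) q) /\ qpoch_inf (rho ^+ 2) q != 0,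
         (* (i) *)
         forall i j : nat,
           let u := fun k : nat =>
             (-1) ^+ k * q ^+ 'C(k, 2) * (rho ^+ k / qfact q k)
             * Qpoly q rho (i + k) (j + k) x y in
           cvgn (series u) /\
           qHermite q i x * qHermite q j y
             * (omega_prod_inf q rho x y / qpoch_inf (rho ^+ 2) q)
           = limn (series u)
       & (* (ii) *)
         let g := fun n : nat =>
           rho ^+ n / qfact q n * qHermite q n x * qHermite q n y in
         let u := fun k : nat =>
           (-1) ^+ k * q ^+ 'C(k, 2) * (rho ^+ k / qfact q k)
           * Qpoly q rho k k x y in
         [/\ cvgn (series g) /\ limn (series g) != 0,
             1 / limn (series g)
             = omega_prod_inf q rho x y / qpoch_inf (rho ^+ 2) q,
             cvgn (series u)
           & omega_prod_inf q rho x y / qpoch_inf (rho ^+ 2) q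
             = limn (series u)]])
  /\
  (* the case q = 1 *)
  (forall rho x y : R, `|rho| < 1 / 2 ->
     let g := fun n : nat =>
       rho ^+ n / n`!%:R * qHermite 1 n x * qHermite 1 n y in
     let u := fun k : nat =>
       (-1) ^+ k * (rho ^+ k / k`!%:R) * Qpoly 1 rho k k x y in
     [/\ cvgn (series g) /\ limn (series g) != 0,
         cvgn (series u)
       & 1 / limn (series g) = limn (series u)]).
Proof.
have gE (q rho x y : R) : (fun n : nat =>
    rho ^+ n / qfact q n * qHermite q n x * qHermite q n y) =
    kernel_term q rho x y 0 0.
  apply/funext => n; rewrite /kernel_term /kernel_coeff !addn0.
  by rewrite mulrAC -!mulrA [RHS]mulrCA mulrA; ring.
split=> [q rho x y q1 rho1 xS yS|rho x y rho2 g u].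
  have [qN1 /ltW qle1] : -1 < q /\ q < 1.
    by move: q1; rewrite ltr_norml => /andP[].
  have sx := sqr_qHermite_subexp q1 xS; have sy := sqr_qHermite_subexp q1 yS.
  have [C Ch] := qbinom_bounded q1.
  have r1 : `|1 * rho| < 1 by rewrite mul1r.
  have [|g0 S] := alternating_Qpoly_sum qN1 qle1 rho1 sx sy (C := C) r1.
    move=> K N; rewrite expr1n mulr1 normrM; apply: le_trans (Ch N K).
    by rewrite ler_piMl // normrX exprn_ile1 // ltW.
  have rho21 : `|rho ^+ 2| < 1 by rewrite normrX exprn_ilt1.
  have [l ql l0] := qpoch_cvg q1 rho21.
  have ks : subexp (kernel_coeff q x y 0 0) by exact: qHermite_prod_subexp.
  have pm := poisson_mehler q1 ks rho1 ql.
  have om : omega_prod q rho x y @ \oo --> l / kernel q rho x y 0 0.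
    rewrite (_ : omega_prod q rho x y = fun m => kernel q rho x y 0 0 *
        omega_prod q rho x y m * (kernel q rho x y 0 0)^-1).
      by apply: cvgM; [exact: pm | exact: cvg_cst].
    by apply/funext => m; rewrite mulrAC mulfV // mul1r.
  have qE : qpoch_inf (rho ^+ 2) q = l by exact: cvg_lim ql.
  have oE : omega_prod_inf q rho x y / qpoch_inf (rho ^+ 2) q =
      (kernel q rho x y 0 0)^-1.
    rewrite qE (_ : omega_prod_inf q rho x y = l / kernel q rho x y 0 0).
      by rewrite mulrAC mulfV // mul1r.
    exact: cvg_lim om.
  split.
  - by apply/cvg_ex; exists (l / kernel q rho x y 0 0).
  - by split; [apply/cvg_ex; exists l | rewrite qE].
  - by move=> i j u; have [cu uE] := S i j; split=> //; rewrite oE uE.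
  - move=> g u; have [cu uE] := S 0 0; rewrite oE /g gE div1r; split=> //.
      by split=> //; exact: kernel_cvg.
    by rewrite uE !mul1r.
have rho1 : `|rho| < 1 by lra.
have q1 : (-1 : R) < 1 by lra.
have s1 z : subexp (fun n => qHermite 1 n z ^+ 2 / qfact (1 : R) n).
  by under eq_fun do rewrite qfact_q1; exact: sqr_qHermite1_subexp.
have r1 : `|2 * rho| < 1 by rewrite normrM ger0_norm //; lra.
have [|g0 S] := alternating_Qpoly_sum q1 (lexx 1) rho1 (s1 x) (s1 y) (C := 1) r1.
  move=> K N; rewrite expr1n !mul1r qbinom_q1 ger0_norm // -natrX ler_nat.
  exact: bin_le_exp2.
have -> : g = kernel_term 1 rho x y 0 0.
  by rewrite -gE; apply/funext => n; rewrite qfact_q1.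
have [cu uE] := S 0 0.
have -> : u = fun k => (-1) ^+ k * 1 ^+ 'C(k, 2) * (rho ^+ k / qfact 1 k)
                        * Qpoly 1 rho (0 + k) (0 + k) x y.
  by apply/funext => k; rewrite /u expr1n mulr1 qfact_q1.
split=> //; first by split=> //; exact: kernel_cvg.
by rewrite uE !mul1r.
Qed.
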